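(* A dynamical system $(X,T)$ has the small boundary property if and only if $\dim(X,T)=0$.
   Context: A dynamical system is a pair $(X,T)$ where $X$ is a compact metric space and $T$, $\gamma\mapsto T_\gamma$, is a homomorphism from a countable discrete group $\Gamma$ into the group of self-homeomorphisms of $X$. $\mathrm{Prob}(X,T)$ is the set of $T$-invariant Borel probability measures on $X$. Dimension: $\mathrm{Cov}(X)$ is the set of finite open covers of $X$; $\mathcal{V}\succeq\mathcal{U}$ means that every $V\in\mathcal{V}$ is contained in some $U\in\mathcal{U}$; $\mathrm{ord}(\mathcal{V},x)=-1+\sum_{V\in\mathcal{V}}\mathbf{1}_V(x)$ for $x\in X$; and $$\dim(X,T)=\sup_{\mathcal{U}\in\mathrm{Cov}(X)}\ \inf_{\mathcal{V}\in\mathrm{Cov}(X),\,\mathcal{V}\succeq\mathcal{U}}\ \sup_{\mu\in\mathrm{Prob}(X,T)}\int_X \mathrm{ord}(\mathcal{V},x)\,d\mu(x),$$ with $\dim(X,T)$ declared to be $-\infty$ when $\mathrm{Prob}(X,T)=\emptyset$. Small boundary property: the capacity of a Borel set $A\subseteq X$ is $\mathrm{cap}(A,T)=\sup_{\mu\in\mathrm{Prob}(X,T)}\mu(A)$. The system $(X,T)$ has the small boundary property if there is a basis for the topology of $X$ consisting of sets whose boundary has zero capacity; explicitly, for every open set $U\subseteq X$ and every $x\in U$ there is an open neighborhood $V$ of $x$ such that $\mathrm{cap}(\partial V,T)=0$ and $V\subseteq U$, where $\partial V$ is the topological boundary of $V$. *)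

(* Defs.v *)
From HB Require Import structures.
From mathcomp Require Import all_boot all_order all_algebra.
From mathcomp Require Import all_classical all_reals all_analysis.

Set Implicit Arguments.
Unset Strict Implicit.
Unset Printing Implicit Defensive.

Import Order.TTheory GRing.Theory Num.Theory.

Local Open Scope classical_set_scope.
Local Open Scope ring_scope.

(* Pointed, i.e. nonempty: g_sigma_algebraType needs it, and on an empty X the
   small boundary property would hold vacuously while dim = -oo. *)
#[short(type="pmetricType")]
HB.structure Definition PointedMetric (K : numDomainType) :=
  { M of Metric K M & Pointed M }.

Notation borelType X := (g_sigma_algebraType (@open X)).

Definition homeomorphism (X Y : topologicalType) (f : X -> Y) : Prop :=
  continuous f /\
  exists f' : Y -> X, [/\ continuous f', cancel f f' & cancel f' f].

(* T 1 = id follows, since T 1 is bijective and idempotent. *)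
Definition action_by_homeo (G : groupType) (X : topologicalType)
    (T : G -> X -> X) : Prop :=
  (forall g, homeomorphism (T g)) /\
  (forall g h, T (g * h)%g = T g \o T h).

Definition boundary (X : topologicalType) (A : set X) : set X :=
  closure A `\` interior A.

Definition open_covers (X : topologicalType) : set (set (set X)) :=
  [set U | [/\ finite_set U, forall A, U A -> open A
             & \bigcup_(A in U) A = [set: X]]].

Definition refines (X : Type) (V U : set (set X)) : Prop :=
  forall A, V A -> exists2 B, U B & A `<=` B.

Section dynamics.
Context (R : realType) (G : groupType) (X : pmetricType R) (T : G -> X -> X).

Definition inv_prob : set (probability (borelType X) R) :=
  [set mu | forall g (A : set (borelType X)),
     measurable A -> mu (T g @^-1` A) = mu A].

(* As for the dimension, a supremum over an empty set is -oo. *)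
Definition capacity (A : set X) : \bar R :=
  ereal_sup [set mu A | mu in inv_prob].

Definition small_boundary_property : Prop :=
  forall (U : set X) (x : X), open U -> U x ->
    exists V : set X,
      [/\ open V, V x, capacity (boundary V) = 0%E & V `<=` U].

Definition ord (V : set (set X)) (x : X) : R :=
  -1 + \sum_(A \in V) (\1_A x : R).

Definition dyn_dim : \bar R :=
  ereal_sup [set
    ereal_inf [set
      ereal_sup [set (\int[mu]_x (ord V x)%:E)%E | mu in inv_prob]
    | V in [set V | open_covers V /\ refines V U]]
  | U in @open_covers X].

Lemma dyn_dim_noprob : inv_prob = set0 -> dyn_dim = -oo%E.
Proof.
move=> P0; rewrite /dyn_dim P0; apply/eqP; rewrite -leeNy_eq.
apply: ge_ereal_sup => _ [U covU <-]; apply: ereal_inf_lbound.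
by exists U; [split=> // A UA; exists A|rewrite image_set0 ereal_sup0].
Qed.

End dynamics.

(* Main.v *)
Require Import Defs.
From HB Require Import structures.
From mathcomp Require Import all_boot all_order all_algebra.
From mathcomp Require Import finmap lra.
From mathcomp Require Import all_classical all_reals all_analysis.
From mathcomp Require Import measurable_realfun.

Set Implicit Arguments.
Unset Strict Implicit.
Unset Printing Implicit Defensive.

Import Order.TTheory GRing.Theory Num.Theory.
Import numFieldNormedType.Exports.

Local Open Scope classical_set_scope.
Local Open Scope ring_scope.

(** Write null for a set of measure 0 under every invariant probability.

    Dimension 0 gives small boundaries.  For F closed inside W open, take a
    cover V of small mean order refining {W, ~F}.  Let A be the union of the
    members of V that meet F and B the union of the others.  Then
    F `<=` ~B `<=` A `<=` W, and on A `\` ~B = A `&` B two distinct members of V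
    overlap, so that the order is at least 1 and the set has small measure for
    all invariant probabilities at once (dim0_separation).  Starting from
    {x} inside U and repeating this with errors 1/n gives closed sets F_n and
    open sets W_n, with F_n in the interior of F_(n+1) and the closure of
    W_(n+1) in W_n.  The boundary of the union of the F_n lies in every
    W_n `\` F_n, hence is null (dim0_sbp).

    Small boundaries give dimension 0.  Cover X by finitely many open V_i with
    null boundaries, each inside a member of the given cover.  The sets
    V_i minus the closures of the earlier V_j are open and disjoint, and they
    miss only the union B of the boundaries, which is closed and null.  Adding
    the traces of the V_i on a neighborhood N of B yields a cover whose order
    vanishes off N and is at most twice the number of V_i on N
    (sbp_low_order_cover).

    It remains to find N of uniformly small invariant measure
    (null_closed_small_nbhs); this is where compactness of the space of
    invariant measures enters.  If each N had measure above e for some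
    invariant nu_N, the limit of the nu_N along an ultrafilter of shrinking
    neighborhoods would be an invariant measure giving B mass at least e
    (inv_prob_limit).  The limit measure is built from sets alone: the
    ultralimits of the masses of closed sets form a content, and a content on
    the closed sets of a compact normal space induces a Borel measure by inner
    approximation of open sets, outer approximation of all sets, and
    Caratheodory's theorem (content_probability). *)

(** * From contents on closed sets to Borel probabilities *)

(** A content in the sense of Halmos.  Only finite unions appear, because
    countable additivity is lost in an ultralimit of measures; compactness
    restores it in the measure induced by the content. *)
Definition closed_content (R : realType) (X : topologicalType)
    (l : set X -> R) : Prop :=
  l set0 = 0 /\ forall K L : set X, closed K -> closed L ->
    [/\ K `<=` L -> l K <= l L, l (K `|` L) <= l K + l L
      & K `&` L = set0 -> l K + l L <= l (K `|` L)].

Definition inner_content (R : realType) (X : topologicalType)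
    (l : set X -> R) (G : set X) : \bar R :=
  ereal_sup [set (l K)%:E | K in [set K | closed K /\ K `<=` G]].

Definition outer_content (R : realType) (X : topologicalType)
    (l : set X -> R) (A : set X) : \bar R :=
  ereal_inf [set inner_content l G | G in [set G | open G /\ A `<=` G]].

Section outer_content.
Local Open Scope ereal_scope.
Context (R : realType) (X : ptopologicalType) (l : set X -> R)
  (compactX : compact [set: X]) (normalX : normal_space X)
  (contentl : closed_content l).

Lemma inner_content_ge K G : closed K -> K `<=` G ->
  (l K)%:E <= inner_content l G.
Proof. by move=> cK KO; apply: ereal_sup_ubound; exists K. Qed.

Lemma inner_content_ge0 G : 0 <= inner_content l G.
Proof.
rewrite -[0]/(0%:E) -(proj1 contentl).
by apply: inner_content_ge; [exact: closed0|exact: sub0set].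
Qed.

Lemma inner_content_fin_num G : inner_content l G \is a fin_num.
Proof.
rewrite ge0_fin_numE ?inner_content_ge0//.
apply: le_lt_trans (ltry (l setT)); apply: ge_ereal_sup => _ [K [cK _] <-].
rewrite lee_fin; have [+ _ _] := proj2 contentl K setT cK closedT.
exact.
Qed.

Lemma le_inner_content A B : A `<=` B -> inner_content l A <= inner_content l B.
Proof.
move=> AB; apply: ge_ereal_sup => _ [K [cK KA] <-].
by apply: inner_content_ge => //; exact: subset_trans AB.
Qed.

(** Normality separates K `\` A from K `\` B by disjoint open sets; removing
    each of them from K leaves two closed pieces that still fill K. *)
Lemma closed_setU_split (K A B : set X) : closed K -> open A -> open B ->
  K `<=` A `|` B -> exists K1 K2, [/\ closed K1, closed K2,
    K1 `<=` A, K2 `<=` B & K = K1 `|` K2].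
Proof.
move=> cK oA oB KAB.
have [] := (@normal_openP R X).1 normalX (K `\` A) (K `\` B).
- by apply: closedI => //; exact: open_closedC.
- by apply: closedI => //; exact: open_closedC.
- by rewrite -subset0 => x [[/KAB[]]] // ? ? [].
move=> U [V [oU oV AU BV UV]].
exists (K `\` U), (K `\` V); split.
- by apply: closedI => //; exact: open_closedC.
- by apply: closedI => //; exact: open_closedC.
- by move=> x [Kx Ux]; apply: contrapT => Ax; apply: Ux; exact: AU.
- by move=> x [Kx Vx]; apply: contrapT => Bx; apply: Vx; exact: BV.
- by rewrite -setDIr UV setD0.
Qed.

Lemma inner_contentU A B : open A -> open B ->
  inner_content l (A `|` B) <= inner_content l A + inner_content l B.
Proof.
move=> oA oB; apply: ge_ereal_sup => _ [K [cK KAB] <-].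
have [K1 [K2 [cK1 cK2 K1A K2B ->]]] := closed_setU_split cK oA oB KAB.
have [_ + _] := proj2 contentl K1 K2 cK1 cK2.
rewrite -lee_fin EFinD => /le_trans; apply.
by apply: leeD; exact: inner_content_ge.
Qed.

Lemma inner_content_bigsetU (F : (set X)^nat) n : (forall k, open (F k)) ->
  inner_content l (\big[setU/set0]_(i < n) F i) <=
  \sum_(i < n) inner_content l (F i).
Proof.
move=> oF; elim: n => [|n IH].
  rewrite !big_ord0; apply: ge_ereal_sup => _ [K [_ +] <-]; rewrite subset0 => ->.
  by rewrite (proj1 contentl).
rewrite !big_ord_recr/=; apply: (le_trans (inner_contentU _ (oF n))).
  by rewrite -bigcup_mkord; exact: bigcup_open.
exact: leeD2r.
Qed.

Lemma compact_sub_bigsetU (K : set X) (F : (set X)^nat) : closed K ->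
  (forall k, open (F k)) -> K `<=` \bigcup_k F k ->
  exists n, K `<=` \big[setU/set0]_(i < n) F i.
Proof.
move=> cK oF KF.
have : compact K by exact: subclosed_compact compactX _.
rewrite compact_cover => /(_ _ setT F (fun k _ => oF k) KF)[D _ KD].
exists (\max_(i <- enum_fset D) i).+1.
move=> x /KD[i Di Fx]; rewrite -bigcup_mkord; exists i => //=.
by rewrite ltnS; apply: leq_bigmax_seq.
Qed.

(** Countable subadditivity is reduced by compactness to the finite case: a
    closed K inside the union is already covered by finitely many sets. *)
Lemma inner_content_bigcup (F : (set X)^nat) : (forall k, open (F k)) ->
  inner_content l (\bigcup_k F k) <= \sum_(k <oo) inner_content l (F k).
Proof.
move=> oF; apply: ge_ereal_sup => _ [K [cK KF] <-].
have [n Kn] := compact_sub_bigsetU cK oF KF.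
apply: (le_trans (inner_content_ge cK Kn)).
apply: (le_trans (inner_content_bigsetU n oF)).
rewrite -(big_mkord xpredT (fun i => inner_content l (F i))).
by apply: nneseries_lim_ge => k _ _; exact: inner_content_ge0.
Qed.

Lemma outer_content_open G : open G -> outer_content l G = inner_content l G.
Proof.
move=> oG; apply/eqP; rewrite eq_le; apply/andP; split.
  by apply: ereal_inf_lbound; exists G => //; split.
by apply: le_ereal_inf_tmp => _ [G' [_ OO'] <-]; exact: le_inner_content.
Qed.

Lemma outer_content_ge0 A : 0 <= outer_content l A.
Proof.
by apply: le_ereal_inf_tmp => _ [G _ <-]; exact: inner_content_ge0.
Qed.

Lemma outer_content_fin_num A : outer_content l A \is a fin_num.
Proof.
rewrite ge0_fin_numE ?outer_content_ge0//.
have := inner_content_fin_num setT.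
rewrite ge0_fin_numE ?inner_content_ge0//; apply: le_lt_trans.
by apply: ereal_inf_lbound; exists setT => //; split => //; exact: openT.
Qed.

Lemma inner_content_approx G (e : R) : (0 < e)%R ->
  exists K, [/\ closed K, K `<=` G & inner_content l G <= (l K)%:E + e%:E].
Proof.
move=> e0.
have [_ [K [cK KG] <-] Ke] := ub_ereal_sup_adherent e0 (inner_content_fin_num G).
by exists K; split => //; rewrite -leeBlDr// ltW.
Qed.

Lemma outer_content_approx A (e : R) : (0 < e)%R ->
  exists G, [/\ open G, A `<=` G & inner_content l G <= outer_content l A + e%:E].
Proof.
move=> e0.
have [_ [G [oG AG] <-] Oe] := lb_ereal_inf_adherent e0 (outer_content_fin_num A).
by exists G; split => //; exact: ltW.
Qed.

Lemma outer_content0 : outer_content l set0 = 0.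
Proof.
rewrite outer_content_open; last exact: open0.
apply/eqP; rewrite eq_le inner_content_ge0 andbT.
apply: ge_ereal_sup => _ [K [_ +] <-]; rewrite subset0 => ->.
by rewrite (proj1 contentl).
Qed.

Lemma le_outer_content :
  {homo outer_content l : A B / A `<=` B >-> A <= B}.
Proof.
move=> A B AB; apply: le_ereal_inf_tmp => _ [G [oG BO] <-].
by apply: ereal_inf_lbound; exists G => //; split => //; exact: subset_trans BO.
Qed.

Lemma outer_content_sigma_subadditive : sigma_subadditive (outer_content l).
Proof.
move=> A; apply/lee_addgt0Pr => e e0.
apply: le_trans (epsilon_trick _ _ (ltW e0)); last first.
  by move=> n; exact: outer_content_ge0.
have /choice[G OP] : forall n, exists G, [/\ open G, A n `<=` G &
    inner_content l G <= outer_content l (A n) + (e / (2 ^ n.+1)%:R)%:E].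
  by move=> n; apply: outer_content_approx; rewrite divr_gt0.
have oG n : open (G n) by have [] := OP n.
have AG : \bigcup_n A n `<=` \bigcup_n G n.
  by apply: subset_bigcup => n _; have [] := OP n.
apply: (le_trans (le_outer_content AG)).
rewrite outer_content_open; last by apply: bigcup_open => n _.
apply: (le_trans (inner_content_bigcup oG)).
apply: lee_nneseries => n *; first exact: inner_content_ge0.
by have [] := OP n.
Qed.

HB.instance Definition _ := isOuterMeasure.Build R X (outer_content l)
  outer_content0 outer_content_ge0 le_outer_content
  outer_content_sigma_subadditive.

(** Enclose A in an open W of nearly the same outer content, fill W `&` G by a
    closed K and then W `\` K by a closed L.  As K and L are disjoint inside W,
    l K + l L is at most the content of W, while K nearly exhausts the part of
    A inside G and W `\` K contains the part outside. *)
Lemma open_caratheodory G : open G -> (outer_content l).-caratheodory G.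
Proof.
move=> oG; apply: le_caratheodory_measurable => A.
apply/lee_addgt0Pr => e e0.
change (outer_content l (A `&` G) + outer_content l (A `&` ~` G) <=
  outer_content l A + e%:E).
have e3 : (0 < e / 3)%R by rewrite divr_gt0.
have [W [oW AW We]] := outer_content_approx A e3.
have oWO : open (W `&` G) by exact: openI.
have [K [cK KWO Ke]] := inner_content_approx (W `&` G) e3.
have oWK : open (W `\` K) by apply: openI => //; exact: closed_openC.
have [L [cL LWK Le]] := inner_content_approx (W `\` K) e3.
have KLW : (l K)%:E + (l L)%:E <= inner_content l W.
  rewrite -EFinD; have [_ _ /(_ _)KL] := proj2 contentl K L cK cL.
  apply: (@le_trans _ _ (l (K `|` L))%:E).
    by rewrite lee_fin; apply: KL; rewrite -subset0 => x [Kx /LWK[_ ]].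
  apply: inner_content_ge; first exact: closedU.
  by move=> x [/KWO[]|/LWK[]].
have AG : outer_content l (A `&` G) <= inner_content l (W `&` G).
  by rewrite -outer_content_open//; apply: le_outer_content; exact: setSI.
have AC : outer_content l (A `&` ~` G) <= inner_content l (W `\` K).
  rewrite -outer_content_open//; apply: le_outer_content => x [Ax Ox].
  by split; [exact: AW|move/KWO => []].
move: We Ke Le KLW AG AC.
rewrite -(fineK (inner_content_fin_num W)).
rewrite -(fineK (inner_content_fin_num (W `&` G))).
rewrite -(fineK (inner_content_fin_num (W `\` K))).
rewrite -(fineK (outer_content_fin_num A)).
rewrite -(fineK (outer_content_fin_num (A `&` G))).
rewrite -(fineK (outer_content_fin_num (A `&` ~` G))).
rewrite -!EFinD !lee_fin.
move: (fine _) (fine _) (fine _) (fine _) (fine _) (fine _) => a b c d f g.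
lra.
Qed.

Lemma borel_caratheodory (A : set (borelType X)) :
  measurable A -> (outer_content l).-caratheodory A.
Proof.
have mO : open `<=` (measurable : set_system (caratheodory_type (outer_content l))).
  by move=> G; exact: open_caratheodory.
exact: (smallest_sub (@sigma_algebra_measurable _
   (caratheodory_type (outer_content l))) mO).
Qed.

Context (l1 : l setT = 1%R).

(** The outer content with domain retyped, to carry the measure structure on
    the Borel sigma-algebra. *)
Definition content_measure : set (borelType X) -> \bar R := outer_content l.

Let content_measure0 : content_measure set0 = 0.
Proof. exact: outer_content0. Qed.

Let content_measure_ge0 A : 0 <= content_measure A.
Proof. exact: outer_content_ge0. Qed.

Let content_measure_sigma_additive : semi_sigma_additive content_measure.
Proof.
move=> A mA tA mU; apply: (@caratheodory_measure_sigma_additive R X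
  (outer_content l)) => //.
  by move=> n; exact: borel_caratheodory.
exact: borel_caratheodory.
Qed.

HB.instance Definition _ := isMeasure.Build _ _ _ content_measure
  content_measure0 content_measure_ge0 content_measure_sigma_additive.

Let content_measureT : content_measure setT = 1.
Proof.
rewrite /content_measure outer_content_open; last exact: openT.
apply/eqP; rewrite eq_le -l1 (inner_content_ge closedT)// andbT.
apply: ge_ereal_sup => _ [K [cK _] <-]; rewrite lee_fin.
by have [+ _ _] := proj2 contentl K setT cK closedT; exact.
Qed.

HB.instance Definition _ :=
  Measure_isProbability.Build _ _ _ content_measure content_measureT.

Lemma content_probability : exists mu : probability (borelType X) R,
  forall A, mu A = outer_content l A.
Proof. by exists content_measure. Qed.

End outer_content.

(** * Borel sets and normality *)

Lemma normal_shrink (X : topologicalType) (F G : set X) : normal_space X ->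
  closed F -> open G -> F `<=` G ->
  exists H, [/\ open H, F `<=` H & closure H `<=` G].
Proof.
move=> nX cF oG FG.
have [|W /set_nbhsP[H [oH FH HW]] WG] := nX F cF G.
  by apply/set_nbhsP; exists G; split.
by exists H; split => //; exact: subset_trans (closureS HW) WG.
Qed.

Lemma open_borel (X : ptopologicalType) (A : set X) :
  open A -> measurable (A : set (borelType X)).
Proof. exact: sub_sigma_algebra. Qed.

Lemma closed_borel (X : ptopologicalType) (A : set X) :
  closed A -> measurable (A : set (borelType X)).
Proof.
move=> cA; rewrite -[A]setCK; apply: measurableC.
by apply: open_borel; exact: closed_openC.
Qed.

(** * Ultralimits of invariant probabilities *)

Lemma ultra_map (I T : Type) (U : set_system I) (f : I -> T) :
  UltraFilter U -> UltraFilter (f @ U).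
Proof.
move=> UU; split=> [|G GG UG]; first exact: fmap_proper_filter.
rewrite eqEsubset; split=> // A GA.
have [//|UA] := in_ultra_setVsetC (f @^-1` A) UU.
have /filter_ex[x [Ax /(_ Ax)//]] : G (A `&` ~` A).
by apply: filterI => //; exact: UG.
Qed.

Lemma ultra_cvg_itv (R : realType) (I : Type) (U : set_system I)
    (u : I -> R) (a b : R) : UltraFilter U -> (forall i, a <= u i <= b) ->
  cvg (u i @[i --> U]).
Proof.
move=> UU uab; have := @segment_compact R a b; rewrite compact_ultra.
move=> /(_ (u @ U) (ultra_map _ UU))[|l [_ ul]].
  by apply: (@filterE _ _ _ (u @^-1` `[a, b])) => i; rewrite /= in_itv /= uab.
by apply/cvg_ex; exists l.
Qed.

Lemma le_filter_lim (R : realType) (I : Type) (U : set_system I)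
    (u v : I -> R) (a b : R) : ProperFilter U ->
  u @ U --> a -> v @ U --> b -> (forall i, u i <= v i) -> a <= b.
Proof.
move=> FU ua vb uv; rewrite -subr_ge0.
apply: (cvgr_to_ge (cvgB vb ua)); apply: nearW => i /=.
by rewrite subr_ge0.
Qed.

Definition ultralimit (R : realType) (X : ptopologicalType) (I : Type)
    (U : set_system I) (nu : I -> probability (borelType X) R)
    (A : set X) : R := lim (fine (nu i A) @[i --> U]).

Section ultralimit.
Context (R : realType) (X : ptopologicalType) (I : Type) (U : set_system I).
Context (nu : I -> probability (borelType X) R) (UU : UltraFilter U).

Lemma ultralimit_cvg A : measurable (A : set (borelType X)) ->
  fine (nu i A) @[i --> U] --> ultralimit U nu A.
Proof.
move=> mA; apply: (@ultra_cvg_itv _ _ _ _ 0 1) => // i.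
rewrite fine_ge0//= -lee_fin fineK ?fin_num_measure//.
exact: probability_le1.
Qed.

Lemma ultralimit_closed_content : closed_content (ultralimit U nu).
Proof.
have nuE A : measurable (A : set (borelType X)) ->
    forall i, ((fine (nu i A))%:E = nu i A)%E.
  by move=> mA i; rewrite fineK// fin_num_measure.
split.
  rewrite /ultralimit (_ : (fun i => _) = cst 0) ?lim_cst//.
  by apply/funext => i; rewrite measure0.
move=> K L /closed_borel mK /closed_borel mL.
have mKL := measurableU _ _ mK mL.
have cK := ultralimit_cvg mK; have cL := ultralimit_cvg mL.
have cKL := ultralimit_cvg mKL.
have cD : fine (nu i K) + fine (nu i L) @[i --> U] -->
    ultralimit U nu K + ultralimit U nu L by exact: cvgD.
split.
- move=> KL; apply: (le_filter_lim _ cK cL) => i.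
  by rewrite -lee_fin !nuE// le_measure// inE.
- apply: (le_filter_lim _ cKL cD) => i /=.
  by rewrite -lee_fin EFinD !nuE// measureU2.
- move=> KL0; apply: (le_filter_lim _ cD cKL) => i /=.
  by rewrite -lee_fin EFinD !nuE// measureU.
Qed.

Lemma ultralimit1 : ultralimit U nu setT = 1.
Proof.
rewrite /ultralimit (_ : (fun i => _) = cst 1) ?lim_cst//.
by apply/funext => i; rewrite probability_setT.
Qed.

End ultralimit.

Lemma continuous_preimage_borel (X : ptopologicalType) (f : X -> X)
    (A : set X) : continuous f -> measurable (A : set (borelType X)) ->
  measurable (f @^-1` A : set (borelType X)).
Proof.
move=> cf mA; rewrite -[X in measurable X]setTI.
apply: (@measurability _ _ (borelType X) (borelType X) setT f open erefl) => //.
move=> _ [G oG <-]; rewrite setTI.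
by apply: open_borel; move/continuousP: cf; apply.
Qed.

(** This replaces the compactness of the space of invariant measures: mu is the
    measure of the content of ultralimits, and the second property is the
    upper semicontinuity of the mass of a closed set. *)
Lemma inv_prob_limit (R : realType) (G : groupType) (X : pmetricType R)
    (T : G -> X -> X) (I : Type) (U : set_system I)
    (nu : I -> probability (borelType X) R) :
  compact [set: X] -> action_by_homeo T -> UltraFilter U ->
  (forall i, inv_prob T (nu i)) ->
  exists2 mu, inv_prob T mu &
    forall (B : set X) (e : R), closed B ->
      (forall N, open N -> B `<=` N -> \forall i \near U, (e%:E <= nu i N)%E) ->
      (e%:E <= mu B)%E.
Proof.
move=> compactX [homT _] UU inv_nu.
have normalX : normal_space X.
  by apply: compact_normal => //; exact: (@metric_hausdorff R).
pose l := ultralimit U nu.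
have lcvg := @ultralimit_cvg R X I U nu UU.
have lc : closed_content l := @ultralimit_closed_content R X I U nu UU.
have [mu muE] := content_probability compactX normalX lc (@ultralimit1 R X I U nu UU).
exists mu.
- move=> g A mA.
  have [cT [S [cS TS ST]]] := homT g.
  (* Passing to complements turns this inequality into the equality sought;
     it holds because T g carries closed subsets of a preimage to closed sets
     of the same limiting mass, S being the inverse of T g. *)
  have le_mu B : (mu (T g @^-1` B) <= mu B)%E.
    rewrite !muE; apply: le_ereal_inf_tmp => _ [V [oV BV] <-].
    apply: (@le_trans _ _ (inner_content l (T g @^-1` V))).
      apply: ereal_inf_lbound; exists (T g @^-1` V) => //; split.
        by move/continuousP: cT; apply.
      exact: preimage_subset.
    apply: ge_ereal_sup => _ [K [cK KV] <-].
    have cSK : closed (S @^-1` K) by move/continuous_closedP: cS; apply.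
    have TSK : T g @^-1` (S @^-1` K) = K.
      by apply/seteqP; split => x; rewrite /preimage/= TS.
    have -> : l K = l (S @^-1` K).
      rewrite /l /ultralimit; suff -> : (fun i => fine (nu i K)) =
        (fun i => fine (nu i (S @^-1` K))) by [].
      apply/funext => i.
      by rewrite -[in RHS](inv_nu i g _ (closed_borel cSK)) TSK.
    by apply: inner_content_ge => // x /KV; rewrite /preimage/= ST.
  have mTA := continuous_preimage_borel cT mA.
  apply/eqP; rewrite eq_le le_mu /=.
  have := le_mu (~` A); rewrite preimage_setC !probability_setC//.
  by rewrite leeD2lE// leeN2.
- move=> B e cB eB; rewrite muE.
  apply: le_ereal_inf_tmp => _ [V [oV BV] <-].
  (* The hypothesis bounds masses of open sets, l is controlled on closed ones:
     the closure of W has the mass of the former and lies inside V. *)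
  have [W [oW BW WV]] := normal_shrink normalX cB oV BV.
  apply: (@le_trans _ _ (l (closure W))%:E); last first.
    by apply: inner_content_ge => //; exact: closed_closure.
  have mW := closed_borel (@closed_closure _ W).
  rewrite lee_fin; apply: (cvgr_to_ge (lcvg _ mW)).
  apply: filterS (eB _ oW BW) => i /=.
  rewrite -lee_fin fineK ?fin_num_measure// => /le_trans; apply.
  by apply: le_measure; rewrite ?inE//; [exact: open_borel|exact: subset_closure].
Qed.

(** Upper semicontinuity of the capacity at a closed null set.  The ultrafilter
    lives on the neighborhoods of B themselves, ordered by shrinking, so that
    no sequence of neighborhoods has to be chosen. *)
Lemma null_closed_small_nbhs (R : realType) (G : groupType)
    (X : pmetricType R) (T : G -> X -> X) (B : set X) (e : R) :
  compact [set: X] -> action_by_homeo T -> closed B ->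
  (forall mu, inv_prob T mu -> (mu B <= 0)%E) -> 0 < e ->
  exists N, [/\ open N, B `<=` N &
    forall mu, inv_prob T mu -> (mu N <= e%:E)%E].
Proof.
move=> compactX actT cB B0 e0; apply: contrapT => noN.
have bigN N : open N -> B `<=` N ->
    exists2 mu, inv_prob T mu & (e%:E < mu N)%E.
  move=> oN BN; apply: contrapT => nomu; apply: noN; exists N; split=> // mu imu.
  by rewrite leNgt; apply/negP => emu; apply: nomu; exists mu.
have [B_eq0|/set0P B_neq0] := eqVneq B set0.
  have [||mu _] := bigN set0; [exact: open0|by rewrite B_eq0|].
  by rewrite measure0 ltNge lee_fin ltW.
have PF : ProperFilter (set_nbhs B) by exact: set_nbhs_pfilter.
(* Neighborhoods need not be Borel, hence the interior. *)
have /choice[nu nuP] : forall W, exists mu, inv_prob T mu /\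
    (set_nbhs B W -> (e%:E < mu W°)%E).
  move=> W; have [BW|nBW] := pselect (set_nbhs B W); last first.
    by have [|//|mu imu _] := bigN setT; [exact: openT|exists mu].
  have [||mu imu emu] := bigN W°; first exact: open_interior.
    by move=> x /BW.
  by exists mu.
have [U [UU FU]] := ultraFilterLemma (powerset_filter_from_filter PF).
have [W|mu imu muB] := @inv_prob_limit _ _ _ T _ U nu compactX actT UU.
  by have [] := nuP W.
have := B0 mu imu; rewrite leNgt => /negP; apply.
rewrite (lt_le_trans _ (muB B e cB _)) ?lte_fin// => N oN BN.
apply: FU; have BNn : set_nbhs B N by apply/set_nbhsP; exists N; split.
near=> W.
have [_ /(_ _)eW] := nuP W.
apply: (le_trans (ltW (eW _))); first by near: W; exact: near_small_set.
apply: le_measure; rewrite ?inE; [|exact: open_borel|].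
  by apply: open_borel; exact: open_interior.
apply: subset_trans (@interior_subset _ _) _.
by near: W; exact: small_set_sub.
Unshelve. all: by end_near. Qed.

(** * The order of a finite open cover *)

Section cover_order.
Context (R : realType) (X : pmetricType R).

Lemma ord_seq (s : seq (set X)) x : uniq s ->
  ord [set` s] x = -1 + \sum_(A <- s) \1_A x.
Proof. by move=> us; rewrite /ord -fsbig_seq. Qed.

Lemma finite_uniq_seq (V : set (set X)) : finite_set V ->
  exists2 s : seq (set X), uniq s & V = [set` s].
Proof.
move=> fV; exists (enum_fset (fset_set V)); first exact: fset_uniq.
by apply/seteqP; split => A /=; rewrite in_fset_set// inE.
Qed.

Lemma ord_measurable (V : set (set X)) : open_covers V ->
  measurable_fun setT (ord V : borelType X -> R).
Proof.
move=> [fV oV _]; have [s us Vs] := finite_uniq_seq fV.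
rewrite (_ : (ord V : borelType X -> R) = (fun x : borelType X =>
    -1 + \sum_(A <- s) (if A \in s then \1_A x else 0))); last first.
  apply/funext => x; rewrite Vs ord_seq//; congr (_ + _).
  by apply: eq_big_seq => A ->.
apply: measurable_funD => //; apply: measurable_sum => A.
have [sA|//] := boolP (A \in s); apply: measurable_indic; apply: open_borel.
by apply: oV; rewrite Vs.
Qed.

Lemma ord_ge0 (V : set (set X)) x : open_covers V -> 0 <= ord V x.
Proof.
move=> [fV _ cV]; have [s us Vs] := finite_uniq_seq fV.
have [A VA Ax] : (\bigcup_(A in V) A) x by rewrite cV.
have sA : A \in s by move: VA; rewrite Vs.
rewrite Vs ord_seq// (bigD1_seq A)//= indicE mem_set// addrA addNr add0r.
by apply: sumr_ge0 => B _; rewrite indicE.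
Qed.

Lemma ord_ge1 (V : set (set X)) A B x : finite_set V ->
  V A -> V B -> A != B -> A x -> B x -> 1 <= ord V x.
Proof.
move=> fV + + AB Ax Bx; have [s us ->] := finite_uniq_seq fV => /= sA sB.
rewrite ord_seq// (bigD1_seq A)//= indicE mem_set// addrA addNr add0r.
rewrite -big_filter (bigD1_seq B)/= ?filter_uniq ?mem_filter ?sB 1?eq_sym ?AB//.
by rewrite indicE mem_set// lerDl sumr_ge0// => C _; rewrite indicE.
Qed.

Lemma ord_le_size (s : seq (set X)) x : uniq s ->
  ord [set` s] x <= (size s)%:R.
Proof.
move=> us; rewrite ord_seq// (@le_trans _ _ (\sum_(A <- s) \1_A x))//.
  by rewrite gerDr lerN10.
rewrite -sum1_size natr_sum; apply: ler_sum => A _.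
by rewrite indicE ler_nat leq_b1.
Qed.

Lemma ord_le0 (s : seq (set X)) x : uniq s ->
  (forall A B, A \in s -> B \in s -> A x -> B x -> A = B) ->
  ord [set` s] x <= 0.
Proof.
move=> us uA; rewrite ord_seq// addrC subr_le0.
have [[A sA Ax]|noA] := pselect (exists2 A, A \in s & A x); last first.
  rewrite big_seq big1// => A sA; rewrite indicE memNset// => Ax.
  by apply: noA; exists A.
rewrite (bigD1_seq A)//= big_seq_cond big1 ?addr0 => [|B /andP[sB BA]].
  by rewrite indicE lern1 leq_b1.
rewrite indicE memNset// => Bx; move/eqP: BA; apply; exact: uA.
Qed.

End cover_order.

Lemma integral_ord_le (R : realType) (X : pmetricType R)
    (mu : probability (borelType X) R) (V : set (set X)) (N : set X) (c : R) :
  open_covers V -> open N -> 0 <= c -> (forall x, ord V x <= c * \1_N x) ->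
  (\int[mu]_x (ord V x)%:E <= c%:E * mu N)%E.
Proof.
move=> covV oN c0 ordN.
have mN := open_borel oN.
have -> : (c%:E * mu N = \int[mu]_x (c%:E * (\1_N x)%:E))%E.
  rewrite ge0_integralZl_EFin//; first by rewrite integral_indic// setIT.
  by apply/measurable_EFinP; exact: measurable_indic.
apply: ge0_le_integral => //.
- by move=> x _; rewrite lee_fin ord_ge0.
- by apply/measurable_EFinP; exact: ord_measurable.
- by apply: measurable_funeM; apply/measurable_EFinP; exact: measurable_indic.
- by move=> x _; rewrite -EFinM lee_fin.
Qed.

Lemma le_integral_ord (R : realType) (X : pmetricType R)
    (mu : probability (borelType X) R) (V : set (set X)) (D : set X) :
  open_covers V -> open D -> (forall x, D x -> 1 <= ord V x) ->
  (mu D <= \int[mu]_x (ord V x)%:E)%E.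
Proof.
move=> covV oD ordD; have mD := open_borel oD.
rewrite -[D in leLHS]setIT -integral_indic//.
apply: ge0_le_integral => //.
- by apply/measurable_EFinP; exact: measurable_indic.
- by apply/measurable_EFinP; exact: ord_measurable.
move=> x _; rewrite lee_fin indicE; have [|] := boolP (x \in D).
  by rewrite inE => /ordD.
by rewrite ord_ge0.
Qed.

(** * Small boundaries give dimension zero *)

Definition disjoint_part (X : topologicalType) (V : (set X)^nat) (i : nat) :
    set X :=
  V i `\` \bigcup_(j in `I_i) closure (V j).

Section disjoint_part.
Context (X : topologicalType) (V : (set X)^nat) (oV : forall i, open (V i)).

Lemma disjoint_part_open i : open (disjoint_part V i).
Proof.
apply: openI => //; apply: closed_openC; apply: closed_bigcup => //.
by move=> j _; exact: closed_closure.
Qed.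

Lemma disjoint_part_inj i j x :
  disjoint_part V i x -> disjoint_part V j x -> i = j.
Proof.
move=> [Vi ni] [Vj nj]; have [ij|ji|//] := ltngtP i j.
- by exfalso; apply: nj; exists i => //; exact: subset_closure.
- by exfalso; apply: ni; exists j => //; exact: subset_closure.
Qed.

(** Descend to the least j with x in the closure of V j: off the boundaries, x
    lies in V j as soon as it lies in its closure. *)
Lemma disjoint_part_cover n i x : (i < n)%N -> V i x ->
  (forall j, (j < n)%N -> ~ boundary (V j) x) ->
  exists2 j, (j < n)%N & disjoint_part V j x.
Proof.
move=> + + nb; elim/ltn_ind: i => i IH i_n Vi.
have [[j /= ji cj]|nc] := pselect ((\bigcup_(j in `I_i) closure (V j)) x).
  apply: (IH j ji); first exact: ltn_trans i_n.
  apply: contrapT => nVj; apply: (nb j); first exact: ltn_trans i_n.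
  by split=> // /interior_subset.
by exists i.
Qed.

End disjoint_part.

Lemma boundary_closed (X : topologicalType) (A : set X) : closed (boundary A).
Proof.
apply: closedI; first exact: closed_closure.
by apply: open_closedC; exact: open_interior.
Qed.

Lemma measure_bigsetU_le0 (R : realType) (X : ptopologicalType)
    (mu : probability (borelType X) R) (F : (set X)^nat) n :
  (forall i, measurable (F i : set (borelType X))) ->
  (forall i, mu (F i) <= 0)%E -> (mu (\big[setU/set0]_(i < n) F i) <= 0)%E.
Proof.
move=> mF F0; elim: n => [|n IH]; first by rewrite big_ord0 measure0.
rewrite big_ord_recr/=; apply: (le_trans (measureU2 _ _ _)) => //.
  by apply: (@bigsetU_measurable _ (borelType X)).
by rewrite -[leRHS]adde0; exact: leeD IH (F0 n).
Qed.

Section sbp_dim.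
Context (R : realType) (G : groupType) (X : pmetricType R) (T : G -> X -> X)
  (compactX : compact [set: X]) (actT : action_by_homeo T).

Lemma sbp_finite_cover (U : set (set X)) :
  small_boundary_property T -> open_covers U ->
  exists n (V : (set X)^nat), [/\ forall i, open (V i),
    forall i, capacity T (boundary (V i)) = 0%E,
    forall i, exists2 B, U B & V i `<=` B &
    forall x, exists2 i, (i < n)%N & V i x].
Proof.
move=> sbp [_ oU cU].
have /choice[V VP] : forall x, exists V : set X, [/\ open V, V x,
    capacity T (boundary V) = 0%E & exists2 B, U B & V `<=` B].
  move=> x; have [B UB Bx] : (\bigcup_(A in U) A) x by rewrite cU.
  have [V [oV Vx V0 VB]] := sbp B x (oU _ UB) Bx.
  by exists V; split => //; exists B.
move: compactX; rewrite compact_cover => /(_ X setT V)[||D _ DX].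
- by move=> x _; have [] := VP x.
- by move=> x _; exists x => //; have [] := VP x.
exists (size (enum_fset D)), (fun i => V (nth point (enum_fset D) i)); split.
- by move=> i; have [] := VP (nth point (enum_fset D) i).
- by move=> i; have [] := VP (nth point (enum_fset D) i).
- by move=> i; have [] := VP (nth point (enum_fset D) i).
move=> x; have [y Dy Vy] := DX x I.
by exists (index y (enum_fset D)); rewrite ?index_mem ?nth_index.
Qed.

(** The disjoint parts alone have order 0 but miss the boundaries; the traces
    V i `&` N repair this at the cost of order at most n + n on N. *)
Lemma sbp_low_order_cover (U : set (set X)) (e : R) :
  small_boundary_property T -> open_covers U -> 0 < e ->
  exists V, [/\ open_covers V, refines V U &
    forall mu, inv_prob T mu -> (\int[mu]_x (ord V x)%:E <= e%:E)%E].
Proof.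
move=> sbp covU e0; have [n [V [oV V0 VU covV]]] := sbp_finite_cover sbp covU.
pose B := \big[setU/set0]_(i < n) boundary (V i).
have cB : closed B by apply: closed_bigsetU => i _; exact: boundary_closed.
have muB mu : inv_prob T mu -> (mu B <= 0)%E.
  move=> imu; apply: (@measure_bigsetU_le0 _ _ mu (fun i => boundary (V i))) => i.
    by apply: closed_borel; exact: boundary_closed.
  by rewrite -(V0 i); apply: ereal_sup_ubound; exists mu.
pose c : R := (n + n)%:R.
have c10 : 0 < c + 1 by rewrite ltr_wpDl.
have [N [oN BN muN]] := null_closed_small_nbhs compactX actT cB muB
  (divr_gt0 e0 c10).
(* The same set may occur twice in the list, but a cover is a set of sets. *)
pose s := undup ([seq disjoint_part V i | i <- iota 0 n] ++
                 [seq V i `&` N | i <- iota 0 n]).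
have sP A : A \in s -> exists i, (A = disjoint_part V i \/ A = V i `&` N).
  rewrite mem_undup mem_cat => /orP[] /mapP[i _ ->]; exists i; by [left|right].
have us : uniq s by exact: undup_uniq.
have disc x : ~ N x -> exists2 i, (i < n)%N & disjoint_part V i x.
  move=> Nx; have [i i_n Vx] := covV x.
  apply: (disjoint_part_cover i_n Vx) => j jn bj; apply: Nx; apply: BN.
  by rewrite /B -(bigcup_mkord n (fun i => boundary (V i))); exists j.
have covs : open_covers [set` s].
  split; first exact: finite_seq.
  - move=> A /sP[i [|] ->]; first exact: disjoint_part_open.
    exact: openI.
  - apply/seteqP; split => // x _; have [Nx|Nx] := pselect (N x).
      have [i i_n Vx] := covV x; exists (V i `&` N) => //=.
      rewrite mem_undup mem_cat; apply/orP; right; apply/mapP; exists i => //.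
      by rewrite mem_iota.
    have [i i_n Vx] := disc x Nx; exists (disjoint_part V i) => //=.
    rewrite mem_undup mem_cat; apply/orP; left; apply/mapP; exists i => //.
    by rewrite mem_iota.
exists [set` s]; split => //.
  move=> A /sP[i Ai]; have [C UC VC] := VU i; exists C => //.
  by case: Ai => ->; apply: subset_trans VC; [exact: subDsetl|exact: subIsetl].
have ordN x : ord [set` s] x <= c * \1_N x.
  rewrite indicE; have [Nx|Nx] := pselect (N x).
    rewrite mem_set// mulr1; apply: (le_trans (ord_le_size _ us)); rewrite ler_nat.
    by apply: (leq_trans (size_undup _)); rewrite size_cat !size_map size_iota.
  rewrite memNset// mulr0; apply: ord_le0 => // A A' /sP[i [|] ->]; last by move=> _ [].
  by move=> /sP[j [|] ->] => [Wi /(disjoint_part_inj Wi) ->|_ []].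
move=> mu imu; apply: (le_trans (integral_ord_le mu covs oN _ ordN)) => //.
apply: (@le_trans _ _ (c%:E * (e / (c + 1))%:E)%E).
  by apply: lee_wpmul2l; [rewrite lee_fin|exact: muN].
rewrite -EFinM lee_fin mulrA ler_pdivrMr// mulrC ler_pM2l//.
by rewrite lerDl.
Qed.

Lemma sbp_dyn_dim_le0 : small_boundary_property T -> (dyn_dim T <= 0)%E.
Proof.
move=> sbp; apply: ge_ereal_sup => _ [U covU <-].
apply/lee_addgt0Pr => e e0; rewrite add0e.
have [V [covV VU Ve]] := sbp_low_order_cover sbp covU e0.
apply: (@le_trans _ _ (ereal_sup
  [set (\int[mu]_x (ord V x)%:E)%E | mu in inv_prob T])).
  by apply: ereal_inf_lbound; exists V.
by apply: ge_ereal_sup => _ [mu imu <-]; exact: Ve.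
Qed.

Lemma dyn_dim_ge0 : inv_prob T !=set0 -> (0 <= dyn_dim T)%E.
Proof.
move=> [mu imu].
have cov1 : @open_covers X [set setT].
  split; [exact: finite_set1|by move=> _ ->; exact: openT|].
  by rewrite bigcup_set1.
apply: le_ereal_sup_tmp; eexists; first by exists [set setT].
apply: le_ereal_inf_tmp => _ [V [covV _] <-].
apply: le_ereal_sup_tmp; eexists; first by exists mu.
by apply: integral_ge0 => x _; rewrite lee_fin ord_ge0.
Qed.

(** The supremum over an empty set of probabilities is -oo, which is not the
    capacity 0 that the property provides. *)
Lemma sbp_inv_prob : small_boundary_property T -> inv_prob T !=set0.
Proof.
move=> sbp; have [V [_ _ + _]] := sbp setT point openT I.
apply: contraPP => /set0P/negP/negPn/eqP P0.
by rewrite /capacity P0 image_set0 ereal_sup0.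
Qed.

End sbp_dim.

(** * Dimension zero gives small boundaries *)

Section dim_sbp.
Context (R : realType) (G : groupType) (X : pmetricType R) (T : G -> X -> X)
  (compactX : compact [set: X]) (dim0 : (dyn_dim T <= 0)%E).

Lemma dim0_low_order_cover (U : set (set X)) (e : R) :
  open_covers U -> 0 < e ->
  exists V, [/\ open_covers V, refines V U &
    forall mu, inv_prob T mu -> (\int[mu]_x (ord V x)%:E <= e%:E)%E].
Proof.
move=> covU e0.
have /ereal_inf_lt[_ [V [covV VU] <-] Ve] : (ereal_inf [set
      ereal_sup [set (\int[mu]_x (ord V x)%:E)%E | mu in inv_prob T]
    | V in [set V | open_covers V /\ refines V U]] < e%:E)%E.
  apply: (@le_lt_trans _ _ 0%E); last by rewrite lte_fin.
  by apply: le_trans dim0; apply: ereal_sup_ubound; exists U.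
exists V; split => // mu imu; apply: ltW; apply: le_lt_trans Ve.
by apply: ereal_sup_ubound; exists mu.
Qed.

(** A member of the refining cover that meets F cannot lie in ~` F, so it lies
    in W; the layer W' `\` F' consists of points where a member meeting F
    overlaps one that does not. *)
Lemma dim0_separation (F W : set X) (e : R) :
  closed F -> open W -> F `<=` W -> 0 < e ->
  exists F' W', [/\ closed F', open W', F `<=` F', F' `<=` W' & W' `<=` W] /\
    forall mu, inv_prob T mu -> (mu (W' `\` F') <= e%:E)%E.
Proof.
move=> cF oW FW e0.
have cov2 : open_covers [set W; ~` F].
  split; first exact: finite_set2.
    by move=> A [->//|->]; exact: closed_openC.
  apply/seteqP; split => // x _; have [Fx|Fx] := pselect (F x).
    by exists W; [left|exact: FW].
  by exists (~` F); [right|].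
have [V [covV V2 Ve]] := dim0_low_order_cover cov2 e0.
have [fV oV cV] := covV.
pose A := \bigcup_(S in [set S | V S /\ S `&` F !=set0]) S.
pose B := \bigcup_(S in [set S | V S /\ S `&` F = set0]) S.
have oA : open A by apply: bigcup_open => S [/oV].
have oB : open B by apply: bigcup_open => S [/oV].
have AB x : A x \/ B x.
  have [S VS Sx] : (\bigcup_(S in V) S) x by rewrite cV.
  have [SF|/set0P SF] := eqVneq (S `&` F) set0.
    by right; exists S.
  by left; exists S.
exists (~` B), A; split; first split => //.
- exact: open_closedC.
- move=> x Fx [S [VS SF] Sx].
  by have : (S `&` F) x by []; rewrite SF.
- by move=> x Bx; have [] := AB x.
- move=> x [S [VS [y [Sy Fy]]] Sx]; have [C [->|->] SC] := V2 S VS.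
    exact: SC.
  by exfalso; exact: SC Sy Fy.
move=> mu imu; rewrite setDE setCK.
apply: (le_trans (le_integral_ord mu covV _ _)) (Ve mu imu).
  exact: openI.
move=> x [[S [VS SF] Sx] [S' [VS' SF'] Sx']].
apply: (ord_ge1 fV VS VS') => //; apply/eqP => SS'.
by move: SF; rewrite SS' SF' => -[].
Qed.

(** Separation between the closure of H and K, where F `<=` H and the closure of
    K lies in W, leaves the room needed to iterate. *)
Lemma dim0_interleave (F W : set X) (e : R) :
  closed F -> open W -> F `<=` W -> 0 < e ->
  exists F' W', [/\ closed F', open W', F `<=` F'°, F' `<=` W'
      & closure W' `<=` W] /\
    forall mu, inv_prob T mu -> (mu (W' `\` F') <= e%:E)%E.
Proof.
move=> cF oW FW e0.
have normalX : normal_space X.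
  by apply: compact_normal => //; exact: (@metric_hausdorff R).
have [H [oH FH HW]] := normal_shrink normalX cF oW FW.
have [K [oK HK KW]] := normal_shrink normalX (@closed_closure _ H) oW HW.
have [F' [W' [[cF' oW' HF' FW' WK'] muOF]]] :=
  dim0_separation (@closed_closure _ H) oK HK e0.
exists F', W'; split => //; split => //.
  apply: (subset_trans FH); rewrite -open_subsetE//.
  by apply: subset_trans HF'; exact: subset_closure.
exact: subset_trans (closureS WK') KW.
Qed.

(** The sets W_n `\` F_n shrink to measure 0 and contain the boundary of the
    union of the F_n, which is open because the F_n are nested strictly. *)
Lemma dim0_sbp : inv_prob T !=set0 -> small_boundary_property T.
Proof.
move=> [mu0 imu0] U x oU Ux.
pose good (FW : set X * set X) := [/\ closed FW.1, open FW.2 & FW.1 `<=` FW.2].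
have /choice[next nextP] : forall nFW : nat * (set X * set X),
    exists FW' : set X * set X, good nFW.2 ->
    [/\ good FW', nFW.2.1 `<=` FW'.1°, closure FW'.2 `<=` nFW.2.2 &
      forall mu, inv_prob T mu ->
        (mu (FW'.2 `\` FW'.1) <= (nFW.1.+1%:R^-1)%:E)%E].
  move=> [n [F W]]; have [[/= cF oW FW]|?] := pselect (good (F, W)); last first.
    by exists (F, W).
  have [|F' [W' [[cF' oW' FF' FW' OO'] muOF]]] :=
    @dim0_interleave _ _ n.+1%:R^-1 cF oW FW; first by rewrite invr_gt0.
  by exists (F', W').
pose fix FW n := if n is m.+1 then next (m, FW m) else ([set x], U).
have goodFW n : good (FW n).
  elim: n => [|n IH]; last by have [] := nextP (n, FW n) IH.
  split => //=; last by move=> _ ->.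
  exact/accessible_closed_set1/hausdorff_accessible/(@metric_hausdorff R).
have FS n : (FW n).1 `<=` ((FW n.+1).1)°.
  by have [] := nextP (n, FW n) (goodFW n).
have OS n : closure (FW n.+1).2 `<=` (FW n).2.
  by have [] := nextP (n, FW n) (goodFW n).
have muS n mu : inv_prob T mu ->
    (mu ((FW n.+1).2 `\` (FW n.+1).1) <= (n.+1%:R^-1)%:E)%E.
  by have [_ _ _] := nextP (n, FW n) (goodFW n); exact.
have FSS n : (FW n).1 `<=` (FW n.+1).1.
  exact: subset_trans (FS n) (@interior_subset _ _).
have OSS n : (FW n.+1).2 `<=` (FW n).2.
  exact: subset_trans (@subset_closure _ _) (OS n).
have FWsub m n : (FW m).1 `<=` (FW n).2.
  have Fm k : (FW m).1 `<=` (FW (m + k)%N).1.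
    by elim: k => [|k IH]; [rewrite addn0|rewrite addnS; exact: subset_trans (FSS _)].
  have On k : (FW (n + k)%N).2 `<=` (FW n).2.
    by elim: k => [|k IH]; [rewrite addn0|rewrite addnS; exact: subset_trans IH].
  have [_ _ FWmn] := goodFW (m + n)%N.
  apply: (subset_trans (Fm n)); apply: (subset_trans FWmn).
  by rewrite addnC.
pose V := \bigcup_n (FW n).1.
have oV : open V.
  have -> : V = \bigcup_n ((FW n).1)°.
    apply/seteqP; split => y [n _ Fy]; last by exists n => //; exact: interior_subset.
    by exists n.+1 => //; exact: FS.
  by apply: bigcup_open => n _; exact: open_interior.
have bV n : boundary V `<=` (FW n.+1).2 `\` (FW n.+1).1.
  move=> y [clVy intVy]; split.
    apply: (OS n.+1); move: y clVy {intVy}; apply: closureS.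
    by move=> y [m _]; exact: FWsub.
  move=> Fy; apply: intVy.
  have : V `<=` V° by rewrite -open_subsetE.
  by apply; exists n.+1.
exists V; split => //; last first.
- by move=> y [m _]; exact: (FWsub m 0%N).
- apply/eqP; rewrite eq_le; apply/andP; split; last first.
    by apply: le_ereal_sup_tmp; exists (mu0 (boundary V)) => //; exists mu0.
  apply: ge_ereal_sup => _ [mu imu <-].
  apply/lee_addgt0Pr => e e0; rewrite add0e.
  have [n _ /(_ n (leqnn n)) ne] := near_infty_natSinv_lt (PosNum e0).
  apply: (le_trans _ (ltW (ne : (n.+1%:R^-1)%:E < e%:E)%E)).
  apply: le_trans (muS n mu imu); apply: le_measure; rewrite ?inE.
  + by apply: closed_borel; exact: boundary_closed.
  + have [cF oW _] := goodFW n.+1.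
    by apply: measurableD; [exact: open_borel|exact: closed_borel].
  + exact: bV.
- by exists 0%N.
Qed.

End dim_sbp.

Theorem theorem5p1 (R : realType) (G : groupType) (X : pmetricType R)
    (T : G -> X -> X)
    (countG : countable [set: G])
    (compactX : compact [set: X])
    (actT : action_by_homeo T) :
  small_boundary_property T <-> dyn_dim T = 0%E.
Proof.
split=> [sbp|dim0].
  apply/eqP; rewrite eq_le sbp_dyn_dim_le0//=.
  by apply: dyn_dim_ge0; exact: sbp_inv_prob sbp.
apply: dim0_sbp => //; first by rewrite dim0.
apply/set0P/eqP => P0; have := dyn_dim_noprob P0.
by rewrite dim0.
Qed.
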